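(* Let $\nu$ be a Borel measure on $\mathbb{R}^d$ with $\nu(C)<\infty$ for every compact $C$. Let $\{S_n\}$ be a sequence of compact non-empty sets in $\mathbb{R}^d$ and let $S\subset\mathbb{R}^d$ be a compact non-empty set such that $\nu(\partial S)=0$, $d_H(S_n,S)\to 0$ and $d_H(\partial S_n,\partial S)\to 0$. Then $d_\nu(S_n,S)\to 0$.
   Context: $\partial A$ denotes the topological boundary of $A\subset\mathbb{R}^d$. For closed, bounded, non-empty $A,C\subset\mathbb{R}^d$ the Hausdorff distance is $d_H(A,C)=\inf\{\epsilon>0:\ C\subset B(A,\epsilon)\text{ and }A\subset B(C,\epsilon)\}$, where $B(A,\epsilon)=\{x\in\mathbb{R}^d:\ \delta_A(x)\leq\epsilon\}$ and $\delta_A(x)=\inf\{\|x-y\|:\ y\in A\}$. For Borel sets $A,C$ of finite $\nu$-measure, the distance in measure is $d_\nu(A,C)=\nu(A\Delta C)$, where $A\Delta C=(A\setminus C)\cup(C\setminus A)$. *)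

(* Defs.v *)
From HB Require Import structures.
From mathcomp Require Import all_boot all_order all_algebra.
From mathcomp Require Import all_classical all_reals all_analysis.

Set Implicit Arguments.
Unset Strict Implicit.
Unset Printing Implicit Defensive.

Import Order.TTheory GRing.Theory Num.Theory.
Import numFieldNormedType.Exports.

Local Open Scope classical_set_scope.
Local Open Scope ring_scope.

(* R^d is the type ['rV[R]_d] of row vectors.  The library's norm [`|x|] on it
   is the sup norm; it induces the usual topology, but distances below are
   measured with the Euclidean norm. *)
Definition enorm (R : realType) (d : nat) (x : 'rV[R]_d) : R :=
  Num.sqrt (\sum_(i < d) (x ord0 i) ^+ 2).

Definition boundary (T : topologicalType) (A : set T) : set T :=
  closure A `\` A°.

Definition dist_to (R : realType) (d : nat) (A : set 'rV[R]_d)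
    (x : 'rV[R]_d) : R :=
  inf [set enorm (x - y) | y in A].

Definition fattening (R : realType) (d : nat) (A : set 'rV[R]_d) (e : R) :
    set 'rV[R]_d :=
  [set x | dist_to A x <= e].

(* Meaningful for closed, bounded, non-empty sets: the real-valued [inf] of an
   empty set, or of a set without lower bound, is 0. *)
Definition hausdorff_dist (R : realType) (d : nat) (A C : set 'rV[R]_d) : R :=
  inf [set e : R | [/\ 0 < e, C `<=` fattening A e & A `<=` fattening C e]].

(* R^d with its Borel sigma-algebra, generated by the open sets. *)
Definition borel_rV (R : realType) (d : nat) :=
  g_sigma_algebraType (@open 'rV[R]_d).

Definition dist_in_measure (R : realType) (d : nat)
    (nu : {measure set (borel_rV R d) -> \bar R}) (A C : set 'rV[R]_d) :
    \bar R :=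
  nu ((A `\` C) `|` (C `\` A)).

(* Main.v *)
Require Import Defs.
From HB Require Import structures.
From mathcomp Require Import all_boot all_order all_algebra.
From mathcomp Require Import all_classical all_reals all_analysis.

Set Implicit Arguments.
Unset Strict Implicit.
Unset Printing Implicit Defensive.

Import Order.TTheory GRing.Theory Num.Theory.
Import numFieldNormedType.Exports.

Local Open Scope classical_set_scope.
Local Open Scope ring_scope.

(** The symmetric difference of [S_ n] and [S] concentrates on the boundary of
    [S].  Suppose both Hausdorff distances are below [r].  A point [x] of one
    set lying outside the other is within [r] of a point of that other set, and
    the segment joining them crosses the boundary of that other set
    ([boundary_between], by connectedness of segments).  So [x] is within [r] of
    the boundary of [S], or of the boundary of [S_ n]; in the second case the
    boundary distance brings it within [2 r] of the boundary of [S]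
    ([symdiff_sub_thickening]).

    The open thickenings of the boundary of [S] by [1/(k+1)] are bounded, hence
    of finite measure, and decrease to the boundary of [S] because it is closed;
    continuity from above gives that their measures tend to
    [nu (boundary S) = 0] ([measure_open_thickening_cvg]).

    The Hausdorff distance is Euclidean while balls are for the sup norm; as the
    sup norm is the smaller one, Euclidean closeness implies sup-norm
    closeness, which is all the argument consumes.

    An infimum over the empty set is [0] by convention, so a small
    [hausdorff_dist] carries information only once both sets are known to be
    bounded and non-empty.  For boundaries this needs the dimension to be
    positive ([compact_boundary_nonempty]); in dimension 0 all non-empty sets
    coincide and the claim is immediate. *)

(** * Boundaries and connectedness *)

Lemma connected_meets_boundary (T : topologicalType) (A B : set T) :
  connected B -> A `&` B !=set0 -> ~` A `&` B !=set0 ->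
  boundary A `&` B !=set0.
Proof.
move=> cB [y [Ay By]] [x [nAx Bx]]; apply: contrapT => nAB.
(* Away from the boundary, [closure A] and [A°] have the same trace on [B],
   which is therefore both open and closed in [B]. *)
have clint z : B z -> closure A z -> A° z.
  move=> Bz clAz; apply: contrapT => nAz; apply: nAB.
  by exists z; split.
have BE : B `&` A° = B.
  apply: cB.
  - by exists y; split=> //; apply: clint => //; exact: subset_closure.
  - by exists A° => //; exact: open_interior.
  - exists (closure A); first exact: closed_closure.
    apply/seteqP; split=> z [Bz Az]; split=> //; last exact: clint.
    by apply: subset_closure; exact: interior_subset.
by move: Bx; rewrite -BE => -[_ /interior_subset].
Qed.

(** The segment from [x] to [y] is connected and meets both [A] and its
    complement. *)
Lemma boundary_between (R : realType) (V : normedModType R) (A : set V)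
    (x y : V) : ~ A x -> A y -> exists2 z, boundary A z & `|x - z| <= `|x - y|.
Proof.
move=> nAx Ay; pose f t := x + t *: (y - x).
have cf : continuous f.
  by move=> t; apply: cvgD; [exact: cvg_cst | apply: cvgZr_tmp; exact: cvg_id].
have [] := @connected_meets_boundary _ A (f @` `[0, 1]%classic).
- apply: connected_continuous_connected; first exact: segment_connected.
  exact: continuous_subspaceT.
- exists y; split=> //; exists 1; rewrite /= ?in_itv/= ?lexx ?ler01//.
  by rewrite /f scale1r addrC subrK.
- exists x; split=> //; exists 0; rewrite /= ?in_itv/= ?lexx ?ler01//.
  by rewrite /f scale0r addr0.
move=> z [bAz [t]]; rewrite /= in_itv/= => /andP[t0 t1] ftz.
exists z => //; rewrite -ftz /f opprD addrA subrr sub0r normrN normrZ.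
by rewrite (distrC x y) ger0_norm// ler_piMl.
Qed.

Lemma closed_boundary (T : topologicalType) (A : set T) : closed (boundary A).
Proof.
apply: closedI; first exact: closed_closure.
exact/open_closedC/open_interior.
Qed.

Lemma closed_boundary_sub (T : topologicalType) (A : set T) :
  closed A -> boundary A `<=` A.
Proof. by move=> /closure_id AE z []; rewrite -AE. Qed.

Lemma compact_boundary (T : topologicalType) (A : set T) :
  hausdorff_space T -> compact A -> compact (boundary A).
Proof.
move=> hT cA; apply: (subclosed_compact (@closed_boundary _ A) cA).
by apply: closed_boundary_sub; exact: compact_closed.
Qed.

(** A compact set misses some point, and the boundary is crossed on the way
    there.  This fails in dimension 0, where the whole space is compact. *)
Lemma compact_boundary_nonempty (R : realType) (d : nat)
    (A : set 'rV[R]_d.+1) : compact A -> A !=set0 -> boundary A !=set0.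
Proof.
move=> /compact_bounded[M [_ AM]] [y Ay].
pose x : 'rV[R]_d.+1 := const_mx (`|M| + 2).
have [|z bz _] := @boundary_between _ _ A x y _ Ay; last by exists z.
move=> /(AM (`|M| + 1)); rewrite (le_lt_trans (ler_norm M)) ?ltrDl//.
move=> /(_ isT); apply/negP; rewrite -ltNge.
apply: (@lt_le_trans _ _ `|x ord0 ord0|).
  by rewrite mxE [ltRHS]ger0_norm ?addr_ge0// ltrD2l ltr1n.
by rewrite [leRHS]/Num.norm/= mx_normrE; apply: (le_bigmax _ _ (ord0, ord0)).
Qed.

(** * From the Euclidean Hausdorff distance to sup-norm closeness *)

Lemma norm_le_enorm (R : realType) (d : nat) (x : 'rV[R]_d) :
  `|x| <= enorm x.
Proof.
rewrite [leLHS]/Num.norm/= mx_normrE; apply: bigmax_le => [|[i j] _] /=.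
  exact: sqrtr_ge0.
rewrite ord1 -sqrtr_sqr ler_wsqrtr// (bigD1 j)//= lerDl.
by apply: sumr_ge0 => k _; exact: sqr_ge0.
Qed.

Lemma enorm_le_norm (R : realType) (d : nat) (x : 'rV[R]_d) :
  enorm x <= Num.sqrt d%:R * `|x|.
Proof.
rewrite -[X in _ * X]ger0_norm// -sqrtr_sqr -sqrtrM// ler_wsqrtr//.
rewrite mulr_natl -[X in _ *+ X](card_ord d) -sumr_const.
apply: ler_sum => i _; rewrite -ler_sqrt ?sqr_ge0// !sqrtr_sqr normr_id.
by rewrite [leRHS]/Num.norm/= mx_normrE; apply: (le_bigmax _ _ (ord0, i)).
Qed.

Lemma fattening_near (R : realType) (d : nat) (A : set 'rV[R]_d) (e r : R)
    (x : 'rV[R]_d) :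
  A !=set0 -> e < r -> fattening A e x -> exists2 y, A y & `|x - y| < r.
Proof.
move=> [a Aa] er xAe.
have [|_ [y Ay <-] xyr] := @inf_lt _ [set enorm (x - y) | y in A] r _
  (le_lt_trans xAe er); first by exists (enorm (x - a)), a.
by exists y => //; exact: le_lt_trans (norm_le_enorm _) xyr.
Qed.

(** Ensures that the infimum defining the Hausdorff distance is not taken over
    the empty set. *)
Lemma bounded_sub_fattening (R : realType) (d : nat) (A C : set 'rV[R]_d) :
  bounded_set C -> A !=set0 -> \forall e \near +oo, C `<=` fattening A e.
Proof.
move=> [M [_ CM]] [a Aa]; pose b := Num.sqrt d%:R * (`|M| + 1 + `|a|).
near=> e => x Cx.
have xM : `|x| <= `|M| + 1.
  by apply: CM Cx; rewrite (le_lt_trans (ler_norm M)) ?ltrDl.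
apply: (@le_trans _ _ (enorm (x - a))).
  apply: ge_inf; last by exists a.
  by exists 0 => _ [y _ <-]; exact: sqrtr_ge0.
apply: (@le_trans _ _ b); last by near: e; apply: nbhs_pinfty_ge; exact: num_real.
apply: le_trans (enorm_le_norm _) _; rewrite ler_wpM2l ?sqrtr_ge0//.
by rewrite (le_trans (ler_normB _ _))// lerD2r.
Unshelve. all: by end_near. Qed.

Lemma hausdorff_dist_lt (R : realType) (d : nat) (A C : set 'rV[R]_d) (r : R) :
  bounded_set A -> bounded_set C -> A !=set0 -> C !=set0 ->
  hausdorff_dist A C < r ->
  (forall x, C x -> exists2 y, A y & `|x - y| < r) /\
  (forall x, A x -> exists2 y, C y & `|x - y| < r).
Proof.
move=> bA bC A0 C0 /inf_lt[|e [e0 CA AC] er].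
  have : \forall e \near +oo,
      [/\ 0 < e, C `<=` fattening A e & A `<=` fattening C e].
    near=> e; split.
    - by near: e; apply: nbhs_pinfty_gt; exact: num_real.
    - by near: e; exact: bounded_sub_fattening.
    - by near: e; exact: bounded_sub_fattening.
  by move=> /filter_ex.
by split=> x; [move=> /CA | move=> /AC]; exact: fattening_near.
Unshelve. all: by end_near. Qed.

(** * Open thickenings *)

Definition open_thickening (R : realType) (V : normedModType R) (A : set V)
  (r : R) : set V := \bigcup_(z in A) ball z r.

Section open_thickening_theory.
Context (R : realType) (V : normedModType R).
Implicit Types (A : set V) (r s : R).

Lemma open_open_thickening A r : open (open_thickening A r).
Proof. by apply: bigcup_open => z _; exact: ball_open. Qed.

Lemma le_open_thickening A r s :
  r <= s -> open_thickening A r `<=` open_thickening A s.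
Proof. by move=> rs x [z Az zx]; exists z => //; exact: le_ball zx. Qed.

(** A point in the intersection is a limit of points of [A]. *)
Lemma bigcap_open_thickening A : closed A ->
  \bigcap_k open_thickening A k.+1%:R^-1 = A.
Proof.
move=> clA; apply/seteqP; split=> [x xA|x Ax k _]; last first.
  by exists x => //; apply: ballxx; rewrite invr_gt0.
apply: clA => B /nbhs_ballP[e /= e0 eB].
have [k _ /(_ _ (leqnn k)) ke] := near_infty_natSinv_lt (PosNum e0).
have [z Az zx] := xA k I; exists z; split=> //; apply: eB.
by apply: ball_sym; apply: le_ball zx; exact: ltW.
Qed.

Lemma bounded_open_thickening A r :
  bounded_set A -> bounded_set (open_thickening A r).
Proof.
move=> [M [_ AM]]; exists (`|M| + 1 + r); split; first exact: num_real.
move=> N MN x [z Az]; rewrite -ball_normE /= distrC => zx.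
have zM : `|z| <= `|M| + 1.
  by apply: AM Az; rewrite (le_lt_trans (ler_norm M)) ?ltrDl.
rewrite (le_trans _ (ltW MN))// -(subrK z x) addrC (le_trans (ler_normD _ _))//.
by rewrite lerD// ltW.
Qed.

End open_thickening_theory.

(** A point [x] of [A] outside [C] is within [r] of [boundary C] directly; a
    point of [C] outside [A] reaches it through [boundary A], hence the radius
    [r + r]. *)
Lemma symdiff_sub_thickening (R : realType) (d : nat)
    (A C : set 'rV[R]_d.+1) (r : R) :
  compact A -> compact C -> A !=set0 -> C !=set0 ->
  hausdorff_dist A C < r -> hausdorff_dist (boundary A) (boundary C) < r ->
  (A `\` C) `|` (C `\` A) `<=` open_thickening (boundary C) (r + r).
Proof.
move=> cA cC A0 C0 hAC hbAC.
have bndb B : compact B -> bounded_set (boundary B : set 'rV[R]_d.+1).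
  by move=> cB; exact/compact_bounded/compact_boundary.
have [CA AC] :=
  hausdorff_dist_lt (compact_bounded cA) (compact_bounded cC) A0 C0 hAC.
have [_ bAC] := hausdorff_dist_lt (bndb _ cA) (bndb _ cC)
  (compact_boundary_nonempty cA A0) (compact_boundary_nonempty cC C0) hbAC.
move=> x [[Ax nCx]|[Cx nAx]].
- have [y Cy xyr] := AC _ Ax.
  have [z bz xz] := boundary_between nCx Cy.
  exists z => //; rewrite -ball_normE /= distrC.
  have xzr := le_lt_trans xz xyr.
  by rewrite (lt_trans xzr)// ltrDl (le_lt_trans _ xzr).
- have [y Ay xyr] := CA _ Cx.
  have [z bz xz] := boundary_between nAx Ay.
  have [w bw zw] := bAC _ bz.
  exists w => //; apply: ball_sym; apply: (@ball_triangle _ _ z).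
    by rewrite -ball_normE /=; exact: le_lt_trans xz xyr.
  by rewrite -ball_normE.
Qed.

(** * Locally finite Borel measures *)

Lemma open_measurable_borel (R : realType) (d : nat) (A : set 'rV[R]_d) :
  open A -> measurable (A : set (borel_rV R d)).
Proof. exact: sub_sigma_algebra. Qed.

Lemma compact_measurable_borel (R : realType) (d : nat) (A : set 'rV[R]_d) :
  compact A -> measurable (A : set (borel_rV R d)).
Proof.
move=> /(compact_closed (@norm_hausdorff _ _)) clA; rewrite -(setCK A).
by apply: measurableC; apply: open_measurable_borel; exact: closed_openC.
Qed.

Lemma locally_finite_bounded (R : realType) (d : nat)
    (nu : {measure set (borel_rV R d) -> \bar R}) (A : set 'rV[R]_d) :
  (forall C : set 'rV[R]_d, compact C -> (nu C < +oo)%E) ->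
  measurable (A : set (borel_rV R d)) -> bounded_set A -> (nu A < +oo)%E.
Proof.
move=> nu_fin mA [M [_ AM]].
pose K : set 'rV[R]_d := closed_ball_ Num.norm 0 (`|M| + 1).
have cK : compact K.
  apply: bounded_closed_compact; last exact: closed_closed_ball_.
  exists (`|M| + 1); split; first exact: num_real.
  move=> N MN x; rewrite /K /closed_ball_ /= sub0r normrN => /le_trans; apply.
  exact: ltW.
apply: le_lt_trans (nu_fin _ cK).
apply: le_measure; rewrite ?inE//; first exact: compact_measurable_borel.
move=> x Ax; rewrite /K /closed_ball_ /= sub0r normrN; apply: AM Ax.
by rewrite (le_lt_trans (ler_norm M)) ?ltrDl.
Qed.

(** Continuity from above along a decreasing sequence of bounded open sets with
    intersection [A]. *)
Lemma measure_open_thickening_cvg (R : realType) (d : nat)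
    (nu : {measure set (borel_rV R d) -> \bar R}) (A : set 'rV[R]_d) :
  (forall C : set 'rV[R]_d, compact C -> (nu C < +oo)%E) -> compact A ->
  nu (open_thickening A k.+1%:R^-1) @[k --> \oo] --> nu A.
Proof.
move=> nu_fin cA.
have clA : closed A by exact: compact_closed.
rewrite -[in nu A](bigcap_open_thickening clA).
have mU k : measurable (open_thickening A k.+1%:R^-1 : set (borel_rV R d)).
  by apply: open_measurable_borel; exact: open_open_thickening.
apply: (@nonincreasing_cvg_mu _ _ _ nu
  (fun k => open_thickening A k.+1%:R^-1 : set (borel_rV R d))) => //.
- apply: locally_finite_bounded => //.
  exact/bounded_open_thickening/compact_bounded.
- exact: bigcap_measurable.
- move=> m n mn; apply/subsetPset; apply: le_open_thickening.
  by rewrite lef_pV2 ?posrE// ler_nat.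
Qed.

(** * Convergence in measure *)

Theorem theorem2 (R : realType) (d : nat)
    (nu : {measure set (borel_rV R d) -> \bar R})
    (nu_fin : forall C : set 'rV[R]_d, compact C -> (nu C < +oo)%E)
    (S_ : nat -> set 'rV[R]_d) (S : set 'rV[R]_d)
    (S_n_compact : forall n, compact (S_ n))
    (S_n_nonempty : forall n, S_ n !=set0)
    (S_compact : compact S)
    (S_nonempty : S !=set0)
    (nu_boundary : nu (boundary S) = 0%E)
    (dH_cvg : hausdorff_dist (S_ n) S @[n --> \oo] --> (0 : R))
    (dH_boundary_cvg :
      hausdorff_dist (boundary (S_ n)) (boundary S) @[n --> \oo] --> (0 : R)) :
  dist_in_measure nu (S_ n) S @[n --> \oo] --> 0%E.
Proof.
case: d => [|d] in nu nu_fin S_ S S_n_compact S_n_nonempty S_compact S_nonempty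
  nu_boundary dH_cvg dH_boundary_cvg *.
  have setTE (A : set 'rV[R]_0) : A !=set0 -> A = setT.
    move=> [a Aa]; apply/seteqP; split=> // x _.
    by rewrite [x]thinmx0 -[0](thinmx0 a).
  rewrite (_ : (fun n => _) = cst 0%E); first exact: cvg_cst.
  apply/funext => n; rewrite /dist_in_measure (setTE _ (S_n_nonempty n)).
  by rewrite (setTE _ S_nonempty) setDv setU0 measure0.
have symdiff_sub k : \forall n \near \oo, (S_ n `\` S) `|` (S `\` S_ n)
    `<=` open_thickening (boundary S) k.+1%:R^-1.
  have k20 : 0 < k.+1%:R^-1 / 2 :> R by rewrite divr_gt0// invr_gt0.
  near=> n; rewrite (splitr k.+1%:R^-1); apply: symdiff_sub_thickening => //.
    by near: n; exact: cvgr_lt dH_cvg _ k20.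
  by near: n; exact: cvgr_lt dH_boundary_cvg _ k20.
have U_cvg : nu (open_thickening (boundary S) k.+1%:R^-1) @[k --> \oo] --> 0%E.
  rewrite -nu_boundary; apply: measure_open_thickening_cvg => //.
  exact: compact_boundary.
have dist_lt e : 0 < e ->
    \forall n \near \oo, (dist_in_measure nu (S_ n) S < e%:E)%E.
  move=> e0.
  have /filter_ex[k Uk_lt] : \forall k \near \oo,
      (nu (open_thickening (boundary S) k.+1%:R^-1) < e%:E)%E.
    move/fine_cvgP: U_cvg => [U_fin U_lim].
    near=> k; rewrite -[nu _]fineK; last by near: k; exact: U_fin.
    by rewrite lte_fin; near: k; exact: cvgr_lt U_lim _ e0.
  near=> n; apply: le_lt_trans Uk_lt; apply: le_measure; rewrite ?inE.
  - by apply: measurableU; apply: measurableD; exact: compact_measurable_borel.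
  - by apply: open_measurable_borel; exact: open_open_thickening.
  - by near: n; exact: symdiff_sub.
have dist_ge0 n : (0 <= dist_in_measure nu (S_ n) S)%E by exact: measure_ge0.
apply/fine_cvgP; split.
  near=> n; rewrite ge0_fin_numE//; apply: (@lt_trans _ _ 1%:E); last exact: ltry.
  by near: n; exact: dist_lt.
apply/cvgr0Pnorm_lt => e e0; near=> n => /=.
rewrite ger0_norm ?fine_ge0// -lte_fin fineK; first by near: n; exact: dist_lt.
rewrite ge0_fin_numE//; apply: (@lt_trans _ _ e%:E); last exact: ltry.
by near: n; exact: dist_lt.
Unshelve. all: by end_near. Qed.
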